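(* Let $X$ be a finite-dimensional CAT(0) cube complex and $S \subset X$ a set of vertices. Then $S$ is a Morse subspace of $X$ if and only if $S$ is contracting.
   Context: A CAT(0) cube complex is identified with its one-skeleton, endowed with the combinatorial (graph) distance $d$. Morse subspace: for a geodesic metric space $X$, a subspace $Y \subset X$ is a Morse subspace if, for every $A>0$ and every $B \geq 0$, there exists a constant $K \geq 0$ such that any $(A,B)$-quasigeodesic in $X$ between any two points of $Y$ lies in the $K$-neighborhood of $Y$. (An $(A,B)$-quasigeodesic is a map $\gamma$ from an interval satisfying $\frac{1}{A}|s-t|-B \leq d(\gamma(s),\gamma(t)) \leq A|s-t|+B$.) Contracting: a subspace $Y$ of a metric space $X$ is contracting if there exists some $K \geq 0$ such that the nearest-point projection onto $Y$ of any ball disjoint from $Y$ has diameter at most $K$ (the projection of a ball being the set of all points of $Y$ that are at minimal distance from some point of the ball). *)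

(* Defs.v *)
From mathcomp Require Import all_boot all_order all_algebra.
From mathcomp Require Import boolp classical_sets reals.
Set Implicit Arguments.
Unset Strict Implicit.
Unset Printing Implicit Defensive.
Import Order.TTheory GRing.Theory Num.Theory.

Local Open Scope ring_scope.
Local Open Scope classical_set_scope.

(* The vertex set of [0,1]^n. *)
Definition vcube (n : nat) := {ffun 'I_n -> bool}.

Definition hamming n (x y : vcube n) : nat := #|[pred i | x i != y i]|.

(* Isometries of [0,1]^m onto a face of [0,1]^n, given by their restriction to
   vertices: a map of vertex sets preserving the Hamming distance sends the
   coordinate directions at a vertex to distinct coordinate directions, so its
   image is the vertex set of an m-dimensional face. *)
Record face_map (m n : nat) := FaceMap {
  face_fun :> vcube m -> vcube n;
  face_funP : forall x y, hamming (face_fun x) (face_fun y) = hamming x y }.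

Definition origin n : vcube n := [ffun=> false].

Definition flip n (x : vcube n) (i : 'I_n) : vcube n :=
  [ffun j => x j (+) (j == i)].

Fact corner_mapP n (x : vcube n) (y z : vcube 0) :
  hamming x x = hamming y z.
Proof.
rewrite /hamming !eq_card0 // => i; last by rewrite !inE eqxx.
by case: i.
Qed.

(* The inclusion of the vertex x in the n-cube. *)
Definition corner_map n (x : vcube n) : face_map 0 n :=
  @FaceMap 0 n (fun=> x) (corner_mapP x).

Definition side_fun n (x : vcube n) (i : 'I_n) (b : vcube 1) : vcube n :=
  if b ord0 then flip x i else x.

Fact side_mapP n (x : vcube n) (i : 'I_n) (b c : vcube 1) :
  hamming (side_fun x i b) (side_fun x i c) = hamming b c.
Proof.
rewrite /hamming /side_fun.
case: (eqVneq (b ord0) (c ord0)) => [bc|bc].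
  rewrite bc !eq_card0 // => j; rewrite !inE ?eqxx //.
  by rewrite (ord1 j) bc eqxx.
apply: (@etrans _ _ 1%N).
  apply: (@eq_card1 _ i) => j; rewrite !inE.
  by move: bc; case: (b ord0); case: (c ord0) => // _; rewrite ffunE;
    case: (x j); case: (j == i).
by apply/esym/(@eq_card1 _ ord0) => j; rewrite (ord1 j) !inE bc.
Qed.

(* The edge of the n-cube that leaves the vertex x in direction i, oriented
   away from x. *)
Definition side_map n (x : vcube n) (i : 'I_n) : face_map 1 n :=
  FaceMap (side_mapP x i).

(* A cube complex obtained by gluing cubes along faces by isometries: [cell n]
   is the set of its parametrised n-cubes, that is, of the compositions of a
   characteristic map [0,1]^n -> X with a symmetry of [0,1]^n, and [face f c] is
   the restriction of c along f. By [face_free] the symmetries act freely, so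
   that an n-cube of X is an orbit and has 2^n n! parametrisations (in
   particular no cube is folded onto itself by the gluing). Cubes need not be
   embedded, and distinct cubes may have the same vertices. *)
Record cubeComplex := CubeComplex {
  cell :> nat -> Type;
  face : forall m n, face_map m n -> cell n -> cell m;
  face_id : forall n (f : face_map n n) (c : cell n),
    f =1 id -> face f c = c;
  face_comp : forall m n p (f : face_map m n) (g : face_map n p)
    (h : face_map m p) (c : cell p),
    h =1 g \o f -> face h c = face f (face g c);
  face_free : forall n (f : face_map n n) (c : cell n),
    face f c = c -> f =1 id }.

Section CubeComplex.
Variable X : cubeComplex.

Definition corner n (c : X n) (x : vcube n) : X 0 := face (corner_map x) c.
Definition side n (c : X n) (x : vcube n) (i : 'I_n) : X 1 :=
  face (side_map x i) c.

(* Elements of [X 1] are oriented edges. *)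
Definition source (e : X 1) : X 0 := corner e (origin 1).
Definition target (e : X 1) : X 0 := corner e (flip (origin 1) ord0).
Definition reverse (e : X 1) : X 1 := side e (flip (origin 1) ord0) ord0.

Definition finite_dimensional : Prop :=
  exists N : nat, forall n, X n -> (n <= N)%N.

(* The vertices of the link of v are the oriented edges e with source v. Its
   (n-1)-simplices are the n-cubes with a marked corner at v; a parametrised
   n-cube c with [corner c (origin n) = v] is such a simplex together with an
   ordering [side c (origin n)] of its vertices. *)
Definition link_simplex (v : X 0) n (e : 'I_n -> X 1) (c : X n) : Prop :=
  corner c (origin n) = v /\ forall i, side c (origin n) i = e i.

Definition link_adjacent (v : X 0) (e f : X 1) : Prop :=
  exists c : X 2, link_simplex v (fun i => if i == ord0 then e else f) c.

(* The vertices of a simplex are distinct, and they determine the simplex. *)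
Definition link_simplicial (v : X 0) : Prop :=
  (forall n (e : 'I_n -> X 1) (c : X n), link_simplex v e c -> injective e) /\
  (forall n (e : 'I_n -> X 1) (c c' : X n),
     link_simplex v e c -> link_simplex v e c' -> c = c').

Definition link_flag (v : X 0) : Prop :=
  forall n (e : 'I_n -> X 1), injective e ->
    (forall i, source (e i) = v) ->
    (forall i j, i != j -> link_adjacent v (e i) (e j)) ->
    exists c : X n, link_simplex v e c.

Definition nonpositively_curved : Prop :=
  forall v, link_simplicial v /\ link_flag v.

Fixpoint edge_path (u v : X 0) (p : seq (X 1)) : Prop :=
  if p is e :: p' then source e = u /\ edge_path (target e) v p' else u = v.

(* The second constructor replaces two consecutive sides of a square by the
   other two. *)
Inductive elementary : seq (X 1) -> seq (X 1) -> Prop :=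
| Backtrack e : elementary [:: e; reverse e] [::]
| AcrossSquare (c : X 2) (i j : 'I_2) (o := origin 2) : i != j ->
    elementary [:: side c o i; side c (flip o i) j]
               [:: side c o j; side c (flip o j) i].

Inductive homotopic (u v : X 0) : seq (X 1) -> seq (X 1) -> Prop :=
| HomotopicStep a l r b : elementary l r ->
    edge_path u v (a ++ l ++ b) -> edge_path u v (a ++ r ++ b) ->
    homotopic u v (a ++ l ++ b) (a ++ r ++ b)
| HomotopicRefl p : edge_path u v p -> homotopic u v p p
| HomotopicSym p q : homotopic u v p q -> homotopic u v q p
| HomotopicTrans p q r :
    homotopic u v p q -> homotopic u v q r -> homotopic u v p r.

(* The fundamental group is the edge-path group of the 2-skeleton. *)
Definition simply_connected : Prop :=
  (forall u v, exists p, edge_path u v p) /\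
  (forall u p, edge_path u u p -> homotopic u u p [::]).

Definition CAT0 : Prop := nonpositively_curved /\ simply_connected.

Definition joined_in (u v : X 0) (n : nat) : bool :=
  `[< exists2 p, edge_path u v p & size p = n >].

(* Junk value 0 when u and v are in different components. *)
Definition vertex_dist (u v : X 0) : nat :=
  if pselect (exists n, joined_in u v n) is left ex then ex_minn ex else 0%N.

Variable R : realType.

(* [Interior e t] is the point at distance t from [source e] on the edge e of
   length 1. It is also presented as [Interior (reverse e) (1 - t)], at distance
   0 from the former; no statement below distinguishes the two. *)
Inductive skeleton : Type :=
| Vertex of X 0
| Interior (e : X 1) (t : R) of 0 < t < 1.

Definition dist_to_vertex (p : skeleton) (v : X 0) : R :=
  match p with
  | Vertex u => (vertex_dist u v)%:R
  | @Interior e t _ => Num.min (t + (vertex_dist (source e) v)%:R)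
                               (1 - t + (vertex_dist (target e) v)%:R)
  end.

(* The last two branches account for the segment joining two points of the
   same edge inside that edge. *)
Definition skeleton_dist (p q : skeleton) : R :=
  match q with
  | Vertex v => dist_to_vertex p v
  | @Interior f s _ =>
      let through_ends := Num.min (s + dist_to_vertex p (source f))
                                  (1 - s + dist_to_vertex p (target f)) in
      match p with
      | Vertex _ => through_ends
      | @Interior e t _ =>
          if `[< e = f >] then Num.min `|t - s| through_ends
          else if `[< e = reverse f >] then
            Num.min `|t - (1 - s)| through_ends
          else through_ends
      end
  end.

End CubeComplex.

Arguments Vertex {X R}.
Arguments skeleton_dist {X R}.

Section MetricNotions.
Variables (R : realType) (T : Type) (d : T -> T -> R).

Definition quasigeodesic (A B a b : R) (g : R -> T) : Prop :=
  forall s t, a <= s <= b -> a <= t <= b ->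
    A^-1 * `|s - t| - B <= d (g s) (g t) <= A * `|s - t| + B.

Definition neighborhood (K : R) (Y : set T) : set T :=
  [set x | exists2 y, Y y & d x y <= K].

Definition morse (Y : set T) : Prop :=
  forall A B : R, 0 < A -> 0 <= B ->
    exists2 K, 0 <= K &
      forall (a b : R) (g : R -> T), a <= b -> quasigeodesic A B a b g ->
        Y (g a) -> Y (g b) ->
        forall t, a <= t <= b -> neighborhood K Y (g t).

Definition closed_ball_at (x : T) (r : R) : set T := [set z | d x z <= r].

Definition projection (Y Z : set T) : set T :=
  [set y | Y y /\ exists2 z, Z z & forall y', Y y' -> d z y <= d z y'].

Definition contracting (Y : set T) : Prop :=
  exists2 K, 0 <= K &
    forall (x : T) (r : R), closed_ball_at x r `&` Y = set0 ->
      forall y y', projection Y (closed_ball_at x r) y ->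
        projection Y (closed_ball_at x r) y' -> d y y' <= K.

End MetricNotions.

(* Main.v *)
Require Import Defs.
From mathcomp Require Import all_boot all_order all_algebra.
From mathcomp Require Import boolp classical_sets reals.
From mathcomp Require Import zify ring lra.

(** The vertices of X form a modular graph, that is, any three of them have a
    median, and for a subset of such a graph the Morse and contracting
    properties are equivalent.

    Medians. Simple connectivity and the link condition are used through the
    group-theoretic method of normal forms. Call two edge paths equivalent if
    they differ by exchanges of the two ways around a square. The flag condition
    for triples of edges, in the form [cube_completion], gives [swapeq_cons]:
    equivalent paths with distinct first edges have equivalents that start by
    going around a square. It follows that edge paths act on the classes of
    reduced paths, that this action only depends on the homotopy class, and that
    all geodesics with the same endpoints are equivalent ([geodesic_swapeq]).
    Applied to geodesics that start with different edges, this is the quadrangle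
    condition ([quadrangle]). The graph is bipartite because elementary
    homotopies preserve the parity of the length, and in a bipartite graph the
    quadrangle condition gives medians ([median]).

    From contracting to Morse ([contracting_morse]), in any metric space in
    which nearest points exist: far from Y, the projection to Y of a
    quasigeodesic moves much more slowly than the quasigeodesic, so that a long
    excursion would be a detour forbidden by the quasigeodesic inequality.

    From Morse to contracting ([morse_coarse_contracting]): let p and q be
    points of Y nearest to x and z, where d(x, z) is at most d(x, p) up to a
    constant. Because geodesics between points of Y remain close to Y, the
    points p and q behave like gates ([morse_gate]). With medians one then
    builds a path from p to q that first follows a geodesic towards x and z up
    to a height comparable to d(p, q), next crosses over and comes down to q; it
    is a quasigeodesic with uniform constants, and its highest point is as far
    from Y as from p. The Morse property thus bounds d(p, q).

    Finally [round] moves the points of the skeleton to vertices, at a bounded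
    cost. *)

Set Implicit Arguments.
Unset Strict Implicit.
Unset Printing Implicit Defensive.
Import Order.TTheory GRing.Theory Num.Theory.
Local Open Scope ring_scope.
Local Open Scope classical_set_scope.

(** * Cubes, squares and edges *)

Section Faces.
Variables (m n : nat) (x : vcube n) (iota : 'I_m -> 'I_n).
Hypothesis iota_inj : injective iota.

(** The face of the n-cube at the corner [x] whose directions are the
    [iota l]; with [m = n] these are also the symmetries of the cube, so that
    one construction yields its faces, translations and permutations of
    directions. *)
Definition span_fun (b : vcube m) : vcube n :=
  [ffun k => x k (+) [exists l, (iota l == k) && b l]].

Lemma span_fun_iota b l : span_fun b (iota l) = x (iota l) (+) b l.
Proof.
rewrite ffunE; congr (_ (+) _); apply/existsP/idP => [[l']|bl].
  by move=> /andP[/eqP/iota_inj->].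
by exists l; rewrite eqxx.
Qed.

Lemma span_fun_out b k : k \notin codom iota -> span_fun b k = x k.
Proof.
move=> kN; rewrite ffunE.
case: existsP => [[l /andP[/eqP lk _]]|_]; last exact: addbF.
by rewrite -lk codom_f in kN.
Qed.

Fact span_mapP b c : hamming (span_fun b) (span_fun c) = hamming b c.
Proof.
rewrite /hamming -(card_image iota_inj); apply: eq_card => k; rewrite !inE.
case: (boolP (k \in codom iota)) => [/codomP[l ->]|kN].
  rewrite fintype.mem_image // !span_fun_iota inE.
  by case: (x _); case: (b l); case: (c l).
rewrite !span_fun_out // eqxx; apply/esym/negP => /fintype.imageP[l _ kl].
by rewrite kl codom_f in kN.
Qed.

Definition span_map : face_map m n := FaceMap span_mapP.

Lemma span_origin : span_fun (origin m) = x.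
Proof.
apply/ffunP => k; rewrite ffunE; case: existsP => [[l]|]; last by rewrite addbF.
by rewrite ffunE andbF.
Qed.

Lemma span_flip b l : span_fun (flip b l) = flip (span_fun b) (iota l).
Proof.
apply/ffunP => k; case: (boolP (k \in codom iota)) => [/codomP[j ->]|kN].
  by rewrite [RHS]ffunE !span_fun_iota ffunE (inj_eq iota_inj) addbA.
rewrite span_fun_out // ffunE span_fun_out //.
by case: eqP kN => [->|]; rewrite ?codom_f ?addbF.
Qed.
End Faces.

Lemma flipK n (x : vcube n) i : flip (flip x i) i = x.
Proof. by apply/ffunP => j; rewrite !ffunE -addbA addbb addbF. Qed.

Lemma flipC n (x : vcube n) i j : flip (flip x i) j = flip (flip x j) i.
Proof. by apply/ffunP => k; rewrite !ffunE -!addbA (addbC (k == i)). Qed.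

Section Complex.
Variable X : cubeComplex.
Implicit Types (e f g : X 1).

Lemma corner_face m n (g : face_map m n) (c : X n) x :
  corner (face g c) x = corner c (g x).
Proof. by rewrite /corner -(face_comp (h := corner_map (g x))). Qed.

Lemma side_face m n (g : face_map m n) (c : X n) x i j :
  g (flip x i) = flip (g x) j -> side (face g c) x i = side c (g x) j.
Proof.
move=> gx; rewrite /side -(face_comp (h := side_map (g x) j)) // => b /=.
by rewrite /side_fun; case: ifP; rewrite ?gx.
Qed.

Lemma source_side n (c : X n) x i : source (side c x i) = corner c x.
Proof. by rewrite /source /side corner_face /= /side_fun ffunE. Qed.

Lemma target_side n (c : X n) x i : target (side c x i) = corner c (flip x i).
Proof. by rewrite /target /side corner_face /= /side_fun !ffunE eqxx. Qed.

Lemma reverse_side n (c : X n) x i :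
  reverse (side c x i) = side c (flip x i) i.
Proof.
rewrite /reverse; apply: etrans (@side_face _ _ (side_map x i) c _ _ i _) _.
  by rewrite /= /side_fun !ffunE eqxx flipK.
by rewrite /= /side_fun !ffunE eqxx.
Qed.

Lemma side_origin1 e : side e (origin 1) ord0 = e.
Proof.
apply: face_id => b; rewrite /= /side_fun.
by apply/ffunP => j; rewrite (ord1 j); case: ifP => be; rewrite !ffunE ?be.
Qed.

Lemma reverseK e : reverse (reverse e) = e.
Proof. by rewrite -{1}[e]side_origin1 !reverse_side flipK side_origin1. Qed.

Lemma reverse_inj : injective (@reverse X).
Proof. exact: (can_inj reverseK). Qed.

Lemma source_reverse e : source (reverse e) = target e.
Proof. exact: source_side. Qed.

Lemma target_reverse e : target (reverse e) = source e.
Proof. by rewrite -source_reverse reverseK. Qed.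

(** [square e a f b]: the edge paths [e, a] and [f, b] are the two ways around a
    square of X from a corner to the opposite one. *)
Definition square e a f b := exists c : X 2,
  [/\ e = side c (origin 2) ord0, a = side c (flip (origin 2) ord0) ord_max,
      f = side c (origin 2) ord_max
    & b = side c (flip (origin 2) ord_max) ord0].

Lemma square_cube n (c : X n) x i j : i != j ->
  square (side c x i) (side c (flip x i) j) (side c x j) (side c (flip x j) i).
Proof.
move=> ij; pose iota (l : 'I_2) := if l == ord0 then i else j.
have iota_inj : injective iota.
  move=> k l; rewrite /iota.
  case: (unliftP ord0 k) => [k' ->|->];
    case: (unliftP ord0 l) => [l' ->|->] //=.
  - by rewrite (ord1 k') (ord1 l').
  - by move=> ji; rewrite ji eqxx in ij.
  - by move=> ji; rewrite ji eqxx in ij.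
exists (face (span_map x iota_inj) c).
have sideE x' k : side (face (span_map x iota_inj) c) x' k =
    side c (span_fun x iota x') (iota k).
  by apply: side_face; rewrite /= span_flip.
by split; rewrite sideE ?span_flip ?span_origin.
Qed.

Lemma square_sym e a f b : square e a f b -> square f b e a.
Proof. by move=> [c [-> -> -> ->]]; exact: square_cube. Qed.

(** The same square, read from its corner [target e]. *)
Lemma square_rot e a f b : square e a f b -> square (reverse e) f a (reverse b).
Proof.
move=> [c [-> -> -> ->]]; rewrite !reverse_side [in X in square _ _ _ X]flipC.
have := @square_cube 2 c (flip (origin 2) ord0) ord0 ord_max isT.
by rewrite flipK.
Qed.

(** The same square, read from the corner opposite to [source e]. *)
Lemma square_opp e a f b : square e a f b ->
  square (reverse a) (reverse e) (reverse b) (reverse f).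
Proof. by move/square_rot/square_sym/square_rot. Qed.

Lemma square_path e a f b : square e a f b ->
  [/\ source e = source f, target e = source a, target f = source b
    & target a = target b].
Proof.
by move=> [c [-> -> -> ->]]; rewrite !source_side !target_side flipC.
Qed.

Hypothesis npc : nonpositively_curved X.

Lemma square_neq e a f b : square e a f b -> e <> f.
Proof.
move=> [c [-> _ -> _]] ef.
have [[inj _] _] := npc (corner c (origin 2)).
have simplex : link_simplex (corner c (origin 2)) (side c (origin 2)) c by [].
by have := inj _ _ _ simplex ord0 ord_max ef.
Qed.

Lemma square_uniq e a f b a' b' :
  square e a f b -> square e a' f b' -> a = a' /\ b = b'.
Proof.
move=> [c [E -> F ->]] [c' [E' -> F' ->]].
have [[_ uni] _] := npc (corner c (origin 2)).
have -> : c = c'; last by [].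
apply: (uni _ (side c (origin 2))); first by split.
split=> [|i].
  by rewrite -(source_side c (origin 2) ord0) -E E' source_side.
case: (unliftP ord0 i) => [k ->|->]; last by rewrite -E.
rewrite (ord1 k) (_ : lift ord0 ord0 = ord_max); last exact: val_inj.
by rewrite -F.
Qed.

Lemma square_uniq_path e a f b f' b' :
  square e a f b -> square e a f' b' -> f = f' /\ b = b'.
Proof.
move=> /square_rot s /square_rot s'.
by have [-> /reverse_inj] := square_uniq s s'.
Qed.

(** Read from its second corner, such a square would have twice the side
    [reverse e]. *)
Lemma square_nobacktrack e f b : ~ square e (reverse e) f b.
Proof. by move/square_rot/square_neq. Qed.

(** By the flag condition the three squares at the common source of [e1], [e2]
    and [e3] are faces of a 3-cube, and [x1], [x2], [x3] are the edges of this
    cube that end at the corner opposite to that source, [xi] being parallel to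
    [ei]. The three squares obtained are the other faces of the cube. *)
Lemma cube_completion e1 e2 e3 a12 a21 a13 a31 a23 a32 :
  square e1 a12 e2 a21 -> square e1 a13 e3 a31 -> square e2 a23 e3 a32 ->
  exists x1 x2 x3, [/\ square a12 x3 a13 x2, square a21 x3 a23 x1
                     & square a31 x2 a32 x1].
Proof.
move=> s12 s13 s23.
pose o1 : 'I_3 := ord0; pose o2 : 'I_3 := lift ord0 ord0.
pose o3 : 'I_3 := ord_max.
pose e (i : 'I_3) := if i == o1 then e1 else if i == o2 then e2 else e3.
have case3 (i : 'I_3) : [\/ i = o1, i = o2 | i = o3].
  by case: i => [[|[|[|//]]] lti];
    [apply: Or31|apply: Or32|apply: Or33]; exact: val_inj.
have adj i j : i != j -> exists a b, square (e i) a (e j) b.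
  by move: (case3 i) (case3 j) => [] -> [] -> // _; rewrite /e /=;
    do ?[by eexists; eexists; eassumption
        |by eexists; eexists; apply: square_sym; eassumption].
have e_inj : injective e.
  move=> i j eij; apply/eqP; apply/negPn/negP => /adj[a [b /square_neq]].
  by rewrite eij.
have [_ /(_ 3%N e e_inj) flag] := npc (source e1).
have src i : source (e i) = source e1.
  case: (eqVneq i o1) => [-> //|/adj[a [b /square_path[-> _ _ _]]] //].
case: flag => [//|i j /adj[a [b [c [E _ F _]]]]|c [_ side_c]].
  exists c; split; first by rewrite -(source_side c (origin 2) ord0) -E src.
  move=> k; case: eqP => [-> //|].
  case: (unliftP ord0 k) => [k' -> _|-> //].
  rewrite (ord1 k') (_ : lift ord0 ord0 = ord_max) //; exact: val_inj.
have sq i j (ij : i != j) := square_cube c (origin 3) ij.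
have := sq o1 o2 isT; have := sq o1 o3 isT; have := sq o2 o3 isT.
rewrite !side_c /e /= => /(square_uniq s23)[-> ->] /(square_uniq s13)[-> ->].
move=> /(square_uniq s12)[-> ->].
exists (side c (flip (flip (origin 3) o2) o3) o1).
exists (side c (flip (flip (origin 3) o1) o3) o2).
exists (side c (flip (flip (origin 3) o1) o2) o3).
split; first exact: square_cube.
- by rewrite flipC; apply: square_cube.
- by rewrite ![flip (flip (origin 3) _) o3]flipC; apply: square_cube.
Qed.

End Complex.

(** * Edge paths up to squares *)

Section Swaps.
Variable X : cubeComplex.
Implicit Types (e f g : X 1) (p q r : seq (X 1)).

(** The congruence generated by exchanging the two ways around a square: the
    part of homotopy that preserves the length of edge paths. *)
Inductive swapeq : seq (X 1) -> seq (X 1) -> Prop :=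
| SwapRefl p : swapeq p p
| SwapCons e p q : swapeq p q -> swapeq (e :: p) (e :: q)
| SwapSquare e a f b p : square e a f b -> swapeq [:: e, a & p] [:: f, b & p]
| SwapTrans p q r : swapeq p q -> swapeq q r -> swapeq p r.

Local Notation "p ~ q" := (swapeq p q) (at level 70).
Local Hint Resolve SwapRefl : core.

Lemma swapeq_sym p q : p ~ q -> q ~ p.
Proof.
elim=> {p q} // [e p q _|e a f b p s|p q r _ qp _ rq].
- exact: SwapCons.
- exact: SwapSquare (square_sym s).
- exact: SwapTrans rq qp.
Qed.

Lemma swapeq_size p q : p ~ q -> size p = size q.
Proof. by elim=> {p q} //= [e p q _ ->|p q r _ -> _ ->]. Qed.

Hypothesis npc : nonpositively_curved X.

(** Two equivalent paths with distinct first edges have equivalent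
    representatives that start by going around a square. The induction is on the
    length and the only serious case is transitivity, where squares spanned by
    the first edges [e, f] and [f, g] meet along [f]: by induction the two
    continuations of [f] either coincide, and then so do the squares, or span a
    third square, and then the three squares are half of a 3-cube whose other
    half contains the square spanned by [e] and [g]. *)
Theorem swapeq_cons e p f q : e :: p ~ f :: q ->
  e = f /\ p ~ q \/
  exists a b r, [/\ square e a f b, p ~ a :: r & q ~ b :: r].
Proof.
pose heads w w' := match w, w' with
  | e :: p, f :: q => e = f /\ p ~ q \/
      exists a b r, [/\ square e a f b, p ~ a :: r & q ~ b :: r]
  | _, _ => True end.
suff headsP n w w' : w ~ w' -> size w = n -> heads w w'.
  by move=> epfq; exact: (headsP _ _ _ epfq erefl).
elim/ltn_ind: n w w' => n IHn w w' ww'; elim: ww' => {w w'} /=.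
- by case=> //= e' p' _; left.
- by move=> e' p' q' pq _ _; left.
- by move=> e' a f' b p' s _; right; exists a, b, p'; split.
- move=> [|e1 p1] [|f1 q1] [|g1 s1] // w12 IH12 w23 IH23 n1;
    do ?[by have := swapeq_size w12|by have := swapeq_size w23].
  have {IH12} := IH12 n1.
  have {IH23} : heads (f1 :: q1) (g1 :: s1).
    by apply: IH23; rewrite -(swapeq_size w12).
  case=> [[<- qs]|[c [d [r2 [s2 qc sd]]]]];
    case=> [[-> pq]|[a [b [r1 [t0 pa qb]]]]].
  + by left; split=> //; exact: SwapTrans qs.
  + by right; exists a, b, r1; split=> //; exact: SwapTrans (swapeq_sym qs) qb.
  + by right; exists c, d, r2; split=> //; exact: SwapTrans qc.
  have bc : b :: r1 ~ c :: r2 by exact: SwapTrans (swapeq_sym qb) qc.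
  have sz : (size (b :: r1) < n)%N.
    by rewrite -(swapeq_size qb) -n1 (swapeq_size w12).
  (* [b] and [c] are the continuations of [f1] in the two squares. *)
  have /= := IHn _ sz _ _ bc erefl.
  case=> [[Ebc r12]|[b' [c' [r3 [s3 r1b r2c]]]]].
    subst c; left.
    case: (square_uniq_path npc (square_sym t0) s2) => <- Ead; subst d.
    split=> //.
    apply: SwapTrans pa (SwapTrans _ (swapeq_sym sd)).
    exact: SwapCons.
  have [x1 [x2 [x3 [t1 t2 t3]]]] := cube_completion npc
    (square_rot (square_sym t0)) (square_rot s2) s3.
  right; exists x3, x2, (reverse x1 :: r3); split=> //.
  - apply: SwapTrans pa (SwapTrans (SwapCons _ r1b) (SwapSquare _ _)).
    by have := square_rot t2; rewrite reverseK.
  - apply: SwapTrans sd (SwapTrans (SwapCons _ r2c) (SwapSquare _ _)).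
    by have := square_rot t3; rewrite reverseK.
Qed.

Lemma swapeq_cancel e p q : e :: p ~ e :: q -> p ~ q.
Proof. by case/swapeq_cons=> [[]|[a [b [r [/(square_neq npc)]]]]]. Qed.

(** A path without this property is called reduced below. *)
Definition backtracks p :=
  exists a e b, p ~ a ++ e :: reverse e :: b.

Lemma backtracks_swapeq p q : p ~ q -> backtracks q -> backtracks p.
Proof. by move=> pq [a [e [b qE]]]; exists a, e, b; exact: SwapTrans qE. Qed.

Lemma backtracks_cons e p : backtracks p -> backtracks (e :: p).
Proof. by move=> [a [f [b pE]]]; exists (e :: a), f, b; exact: SwapCons. Qed.

Lemma backtracks_rev e p q : p ~ reverse e :: q -> backtracks (e :: p).
Proof. by exists [::], e, q; exact: SwapCons. Qed.

(** Let [g] be the first edge of a path equivalent to [e :: p] in which a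
    backtrack is visible. If [g] is not [e] they are exchanged across a square,
    and the induction hypothesis applies to what follows [g]. *)
Lemma backtracks_consE e p : backtracks (e :: p) ->
  backtracks p \/ exists q, p ~ reverse e :: q.
Proof.
move En : (size p) => n; elim: n e p En => [|n IHn] e p pn [[|g a] [f [b]]] /=.
- by move/swapeq_size => /= []; rewrite pn.
- by move/swapeq_size; rewrite /= size_cat pn /=; lia.
- case/swapeq_cons=> [[-> pE]|[c [d [r [s pc fd]]]]]; first by right; exists b.
  case/swapeq_cons: fd => [[Efd _]|[t [u [r' [s' _ rE]]]]].
    by subst d; case: (square_nobacktrack npc (square_sym s)).
  have [Et Eu] := square_uniq npc s' (square_rot (square_sym s)).
  left; exists [::], c, r'; apply: SwapTrans pc (SwapCons _ _).
  by rewrite -Eu.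
- case/swapeq_cons=> [[-> pE]|[c [d [r [s pc dE]]]]].
    by left; exists a, f, b.
  have rn : size r = n by have := swapeq_size pc; rewrite pn /= => -[].
  have : backtracks (d :: r) by exists a, f, b; exact: swapeq_sym.
  case/(IHn _ _ rn) => [br|[r' rE]].
    by left; apply: backtracks_swapeq pc _; exact: backtracks_cons.
  right; exists (g :: r'); apply: SwapTrans pc _.
  apply: SwapTrans (SwapCons _ rE) (SwapSquare _ (square_sym (square_rot s))).
Qed.

(** Prepending an edge to a reduced path and reducing the result. The edge paths
    act in this way on the reduced paths up to [swapeq]; the action is
    compatible with the elementary homotopies, and this yields a normal form
    that is a homotopy invariant. *)
Definition act e p : seq (X 1) :=
  if pselect (exists q, p ~ reverse e :: q) is left ex then projT1 (cid ex)
  else e :: p.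

Lemma act_cancel e p q : p ~ reverse e :: q -> act e p ~ q.
Proof.
move=> pE; rewrite /act; case: pselect => [ex|[]]; last by exists q.
case: cid => q' /= pE'; apply: (@swapeq_cancel (reverse e)).
exact: SwapTrans (swapeq_sym pE') pE.
Qed.

Lemma act_push e p : ~ (exists q, p ~ reverse e :: q) -> act e p = e :: p.
Proof. by rewrite /act; case: pselect. Qed.

Lemma act_swapeq e p q : p ~ q -> act e p ~ act e q.
Proof.
move=> pq; have [[p' pE]|pN] := pselect (exists p', p ~ reverse e :: p').
  apply: SwapTrans (act_cancel pE) (swapeq_sym (act_cancel _)).
  exact: SwapTrans (swapeq_sym pq) pE.
rewrite !act_push //; first exact: SwapCons.
by move=> [q' qE]; apply: pN; exists q'; exact: SwapTrans qE.
Qed.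

Lemma act_reduced e p : ~ backtracks p -> ~ backtracks (act e p).
Proof.
move=> pR; have [[p' pE]|pN] := pselect (exists p', p ~ reverse e :: p').
  move=> bt; apply: pR; apply: (backtracks_swapeq pE); apply: backtracks_cons.
  exact: backtracks_swapeq (swapeq_sym (act_cancel pE)) bt.
by rewrite act_push // => /backtracks_consE[].
Qed.

Lemma act_reverse e p : ~ backtracks p -> act e (act (reverse e) p) ~ p.
Proof.
move=> pR; have [[p' pE]|pN] :=
  pselect (exists p', p ~ reverse (reverse e) :: p').
  apply: SwapTrans (act_swapeq e (act_cancel pE)) _.
  rewrite act_push; first by rewrite reverseK in pE; exact: swapeq_sym.
  move=> [q p'E]; apply: pR; apply: backtracks_swapeq pE _.
  by apply: (@backtracks_rev _ _ q); rewrite reverseK.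
by rewrite [act (reverse e) p]act_push //; exact: act_cancel.
Qed.

(** The case of [act_square] where [a] cancels the first edge of [p]. *)
Let act_square_cancel e a f b p p' : square e a f b -> p ~ reverse a :: p' ->
  act e (act a p) ~ act f (act b p).
Proof.
move=> s pE; apply: SwapTrans (act_swapeq e (act_cancel pE)) _.
have [[q p'E]|p'N] := pselect (exists q, p' ~ reverse e :: q).
  apply: SwapTrans (act_cancel p'E) _; apply: swapeq_sym.
  do 2!apply: act_cancel.
  apply: SwapTrans pE (SwapTrans (SwapCons _ p'E) _).
  exact: SwapSquare (square_opp s).
rewrite act_push // [act b p]act_push.
  apply: swapeq_sym; apply: act_cancel.
  apply: SwapTrans (SwapCons _ pE) (SwapSquare _ _).
  exact/square_sym/square_rot/square_sym.
move=> [q pE']; have := SwapTrans (swapeq_sym pE) pE'.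
case/swapeq_cons=> [[Eab _]|[c [d [r [s' p'E _]]]]].
  exact: (square_neq npc (square_opp s) Eab).
by apply: p'N; exists r; have [<- _] := square_uniq npc s' (square_opp s).
Qed.

Lemma act_square e a f b p : square e a f b ->
  act e (act a p) ~ act f (act b p).
Proof.
move=> s; have [[p' pE]|paN] := pselect (exists p', p ~ reverse a :: p').
  exact: act_square_cancel pE.
have [[p' pE]|pbN] := pselect (exists p', p ~ reverse b :: p').
  exact/swapeq_sym/(act_square_cancel (square_sym s) pE).
have push e' a' f' b' : square e' a' f' b' ->
    ~ (exists q, p ~ reverse a' :: q) -> ~ (exists q, p ~ reverse b' :: q) ->
    act e' (act a' p) = [:: e', a' & p].
  move=> s' a'N b'N; rewrite [act a' p]act_push // act_push //.
  move=> [q /swapeq_cons[[Ea _]|[c [d [r [t pE _]]]]]].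
    by subst a'; exact: (square_nobacktrack npc s').
  have [Ec _] := square_uniq npc t (square_sym (square_rot s')).
  by apply: b'N; exists r; rewrite -Ec.
rewrite (push _ _ _ _ s) // (push _ _ _ _ (square_sym s)) //.
exact: SwapSquare.
Qed.

Definition acts p q := foldr act q p.

Lemma acts_swapeq p q q' : q ~ q' -> acts p q ~ acts p q'.
Proof. by move=> qq'; elim: p => //= e p IHp; exact: act_swapeq. Qed.

Lemma acts_reduced p q : ~ backtracks q -> ~ backtracks (acts p q).
Proof. by move=> qR; elim: p => //= e p IHp; exact: act_reduced. Qed.

Lemma nil_reduced : ~ backtracks [::].
Proof. by move=> [a [e [b /swapeq_size]]]; rewrite size_cat /=; lia. Qed.

Lemma acts_homotopic u v p q : homotopic u v p q -> acts p [::] ~ acts q [::].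
Proof.
elim=> {p q} // [a l r b lr _ _|p q _|p q r _ pq _ qr].
- rewrite /acts !foldr_cat; apply: acts_swapeq.
  have bR : ~ backtracks (foldr act [::] b) by exact/acts_reduced/nil_reduced.
  case: lr => [e|c i j o ij] /=.
  + exact: act_reverse.
  + by apply: act_square; exact: square_cube.
- exact: swapeq_sym.
- exact: SwapTrans qr.
Qed.

(** On reduced paths the normal form is the identity. *)
Lemma acts_id p : ~ backtracks p -> acts p [::] ~ p.
Proof.
elim: p => //= e p IHp pR.
have {}IHp : acts p [::] ~ p by apply: IHp => /(backtracks_cons e).
apply: SwapTrans (act_swapeq e IHp) _; rewrite act_push //.
by move=> [q /backtracks_rev].
Qed.

Definition reverse_path p := rev (map (@reverse X) p).

Lemma acts_reverse_path p q : ~ backtracks q ->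
  acts p (acts (reverse_path p) q) ~ q.
Proof.
elim: p q => //= e p IHp q qR.
rewrite /reverse_path /= rev_cons -cats1 /acts foldr_cat /=.
exact: SwapTrans (act_swapeq e (IHp _ (act_reduced qR))) (act_reverse e qR).
Qed.

End Swaps.

(** * The graph metric on the vertices *)

Section Distance.
Variable X : cubeComplex.
Implicit Types (u v w : X 0%N) (e f : X 1) (p q : seq (X 1)).

Lemma edge_path_cat u w p q : edge_path u w (p ++ q) <->
  exists2 v, edge_path u v p & edge_path v w q.
Proof.
elim: p u => [|e p IHp] u /=.
  by split=> [uq|[v -> //]]; exists u.
split=> [[eu /IHp[v pv vq]]|[v [eu pv] vq]]; first by exists v.
by split=> //; apply/IHp; exists v.
Qed.

Lemma reverse_path_edge_path u v p : edge_path u v p ->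
  edge_path v u (reverse_path p).
Proof.
elim: p u => [//|e p IHp] u /= [eu /IHp pv].
rewrite /reverse_path /= rev_cons -cats1; apply/edge_path_cat.
by exists (target e) => //=; rewrite source_reverse target_reverse.
Qed.

Lemma size_reverse_path p : size (reverse_path p) = size p.
Proof. by rewrite size_rev size_map. Qed.

Lemma swapeq_edge_path u v p q :
  swapeq p q -> edge_path u v p -> edge_path u v q.
Proof.
move=> pq; elim: pq u => {p q}
  [//|e p q _ IH|e a f b p /square_path[s t t' z]|p q r _ IH1 _ IH2] u /=.
- by case=> eu /IH.
- by rewrite s t t' z => -[-> [_ pv]].
- by move=> /IH1/IH2.
Qed.

Lemma homotopic_parity u v p q :
  homotopic u v p q -> odd (size p) = odd (size q).
Proof.
elim=> {p q} // [a l r b lr _ _|p q r _ -> _ -> //].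
by rewrite !size_cat !oddD; case: lr.
Qed.

Lemma vertex_dist_le u v p : edge_path u v p -> (vertex_dist u v <= size p)%N.
Proof.
rewrite /vertex_dist => uvp; case: pselect => // ex.
by case: ex_minnP => m _; apply; apply/asboolP; exists p.
Qed.

Lemma vertex_dist0 u : vertex_dist u u = 0%N.
Proof. by apply/eqP; rewrite -leqn0; exact: (@vertex_dist_le u u [::]). Qed.

Hypothesis cat0 : CAT0 X.

Let npc : nonpositively_curved X := proj1 cat0.

Lemma vertex_dist_path u v :
  exists2 p, edge_path u v p & size p = vertex_dist u v.
Proof.
rewrite /vertex_dist; case: pselect => [ex|[]].
  by case: ex_minnP => m /asboolP.
have [_ [/(_ u v)[p uvp] _]] := cat0.
by exists (size p); apply/asboolP; exists p.
Qed.

Lemma vertex_dist_eq0 u v : vertex_dist u v = 0%N -> u = v.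
Proof. by have [[//|? ?] uvp /= <-] := vertex_dist_path u v. Qed.

Lemma vertex_dist_sym u v : vertex_dist u v = vertex_dist v u.
Proof.
have le w w' : (vertex_dist w w' <= vertex_dist w' w)%N.
  have [p p_path <-] := vertex_dist_path w' w; rewrite -size_reverse_path.
  exact/vertex_dist_le/reverse_path_edge_path.
by apply/eqP; rewrite eqn_leq !le.
Qed.

Lemma vertex_dist_triangle v u w :
  (vertex_dist u w <= vertex_dist u v + vertex_dist v w)%N.
Proof.
have [p p_path <-] := vertex_dist_path u v.
have [q q_path <-] := vertex_dist_path v w.
by rewrite -size_cat; apply: vertex_dist_le; apply/edge_path_cat; exists v.
Qed.

(** Elementary homotopies change the length by 0 or 2. *)
Lemma edge_path_parity u v p q : edge_path u v p -> edge_path u v q ->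
  odd (size p) = odd (size q).
Proof.
move=> pP qP; have [_ [_ /(_ u (p ++ reverse_path q))]] := cat0.
have loop : edge_path u u (p ++ reverse_path q).
  by apply/edge_path_cat; exists v => //; exact: reverse_path_edge_path.
move=> /(_ loop)/homotopic_parity; rewrite size_cat size_reverse_path oddD.
by case: (odd (size p)); case: (odd (size q)).
Qed.

Lemma vertex_dist_parity u v w :
  odd (vertex_dist u v + vertex_dist v w) = odd (vertex_dist u w).
Proof.
have [p pP <-] := vertex_dist_path u v; have [q qP <-] := vertex_dist_path v w.
have [r rP <-] := vertex_dist_path u w; rewrite -size_cat.
by apply: edge_path_parity rP; apply/edge_path_cat; exists v.
Qed.

Lemma vertex_dist_edge e : vertex_dist (source e) (target e) = 1%N.
Proof.
have eP : edge_path (source e) (target e) [:: e] by [].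
have := vertex_dist_le eP.
have [p pP <-] := vertex_dist_path (source e) (target e).
by have := edge_path_parity pP eP; case: p pP => [|e' [|]].
Qed.

Lemma vertex_dist_eq1 u v : vertex_dist u v = 1%N ->
  exists e, source e = u /\ target e = v.
Proof.
move=> uv1; have [p pP] := vertex_dist_path u v; rewrite uv1.
by case: p pP => [|e [|//]] //= [eu ev] _; exists e.
Qed.

Lemma vertex_dist_step u v : u <> v -> exists w,
  vertex_dist u w = 1%N /\ vertex_dist u v = (vertex_dist w v).+1.
Proof.
have [[//|e p] /= [eu pP] sz] := vertex_dist_path u v; exists (target e).
rewrite -{1}eu vertex_dist_edge; split=> //; apply/eqP; rewrite eqn_leq.
rewrite -{2}sz ltnS (vertex_dist_le pP) andbT -add1n -(vertex_dist_edge e) eu.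
exact: vertex_dist_triangle.
Qed.

(** Erasing a backtrack would give a shorter path. *)
Lemma geodesic_reduced u v p : edge_path u v p -> size p = vertex_dist u v ->
  ~ backtracks p.
Proof.
move=> pP szp [a [e [b pE]]].
have /edge_path_cat[w aP /= [ew [_ bP]]] := swapeq_edge_path pE pP.
rewrite target_reverse ew in bP.
have abP : edge_path u v (a ++ b) by apply/edge_path_cat; exists w.
have := vertex_dist_le abP.
by rewrite -szp (swapeq_size pE) !size_cat /=; lia.
Qed.

(** Both paths are reduced, and normal forms are homotopy invariants; as X is
    simply connected, the loop formed by the reverse of [q] and by [p] has the
    normal form [[::]], and the action of [q] on both normal forms gives those
    of [p] and [q]. *)
Theorem geodesic_swapeq u v p q : edge_path u v p -> edge_path u v q ->
  size p = vertex_dist u v -> size q = vertex_dist u v -> swapeq p q.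
Proof.
move=> pP qP szp szq.
have pR := geodesic_reduced pP szp; have qR := geodesic_reduced qP szq.
have [_ [_ /(_ v (reverse_path q ++ p)) loop]] := cat0.
have {}loop : homotopic v v (reverse_path q ++ p) [::].
  apply: loop; apply/edge_path_cat.
  by exists u => //; exact: reverse_path_edge_path.
have := acts_homotopic npc loop; rewrite {1}/acts foldr_cat -/(acts p [::]).
rewrite -/(acts _ _) => /(acts_swapeq npc q) pq.
apply: SwapTrans (swapeq_sym (acts_id npc pR)) (SwapTrans _ (acts_id npc qR)).
apply: SwapTrans (swapeq_sym (acts_reverse_path npc _ _)) pq.
exact/acts_reduced/nil_reduced.
Qed.

(** Continue the edges from [v] to [y] and from [v] to [z] to geodesics from [v]
    to [u]. They are equivalent, and [swapeq_cons] provides a square with sides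
    these two edges; [w] is its corner opposite to [v]. *)
Theorem quadrangle u v y z : y <> z ->
  vertex_dist v y = 1%N -> vertex_dist v z = 1%N ->
  vertex_dist v u = (vertex_dist y u).+1 ->
  vertex_dist v u = (vertex_dist z u).+1 ->
  exists w, [/\ vertex_dist y w = 1%N, vertex_dist z w = 1%N
              & vertex_dist y u = (vertex_dist w u).+1].
Proof.
move=> yz /vertex_dist_eq1[e [ev ey]] /vertex_dist_eq1[f [fv fz]] vy vz.
have [p pP szp] := vertex_dist_path y u.
have [q qP szq] := vertex_dist_path z u.
have epP : edge_path v u (e :: p) by rewrite /= ev ey.
have fqP : edge_path v u (f :: q) by rewrite /= fv fz.
have := geodesic_swapeq epP fqP; rewrite /= szp szq -vy -vz => /(_ erefl erefl).
case/(swapeq_cons npc)=> [[ef _]|[a [b [r [s pE qE]]]]].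
  by case: yz; rewrite -ey -fz ef.
have [_ ea fb ab] := square_path s.
have /= [_ rP] := swapeq_edge_path pE pP.
exists (target a); split.
- by rewrite -ey ea vertex_dist_edge.
- by rewrite ab -fz fb vertex_dist_edge.
apply/eqP; rewrite eqn_leq.
rewrite -{2}szp (swapeq_size pE) ltnS (vertex_dist_le rP) andbT.
rewrite -add1n -(vertex_dist_edge a) -ea ey; exact: vertex_dist_triangle.
Qed.

End Distance.

(** * Medians *)

Section Modular.
Variables (V : Type) (d : V -> V -> nat).
Hypothesis d0 : forall u, d u u = 0%N.
Hypothesis d_sym : forall u v, d u v = d v u.
Hypothesis d_triangle : forall v u w, (d u w <= d u v + d v w)%N.
Hypothesis d_eq0 : forall u v, d u v = 0%N -> u = v.
Hypothesis d_parity : forall u v w, odd (d u v + d v w) = odd (d u w).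
Hypothesis d_step : forall u v, u <> v -> exists w,
  d u w = 1%N /\ d u v = (d w v).+1.
Hypothesis d_quadrangle : forall u v y z, y <> z ->
  d v y = 1%N -> d v z = 1%N ->
  d v u = (d y u).+1 -> d v u = (d z u).+1 ->
  exists w, [/\ d y w = 1%N, d z w = 1%N & d y u = (d w u).+1].

Definition between u m v : Prop := (d u m + d m v = d u v)%N.

(** Induction on [d y z]. Let [y1] be the next vertex on a geodesic from [y] to
    [z]. If [y1] is closer to [x] than [y], a median of [x], [y1] and [z] is a
    median of [x], [y] and [z]. Otherwise let [m] be such a median. If [m] is
    [y1], then [y] is on geodesics from [x] to [z] and is the median. If not,
    move from [y1] towards [m] to a vertex [y2]: both [y] and [y2] are closer to
    [x] than [y1] is, and the quadrangle condition gives a neighbour [t] of [y]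
    that is closer to both [x] and [z]. *)
Theorem median x y z : exists m,
  [/\ between x m y, between y m z & between x m z].
Proof.
rewrite /between; move En : (d y z) => n.
elim: n x y z En => [|n IHn] x y z yz.
  by move: (d_eq0 yz) => <-; exists y; rewrite !d0 addn0.
have step u v w : d u v = 1%N -> d w u = (d w v).+1 \/ d w v = (d w u).+1.
  move=> uv; have := d_parity w u v; rewrite uv addn1 /= => par.
  have := d_triangle u w v; have := d_triangle v w u; rewrite uv (d_sym v u) uv.
  by move: par; case: (ltngtP (d w u) (d w v)) => [|| ->]; [lia|lia|case: odd].
have yNz : y <> z by move=> E; rewrite E d0 in yz.
have [y1 [yy1 y1z]] := d_step yNz.
have {}y1z : d y1 z = n by lia.
have [m [xm1 m1 mz]] := IHn x y1 z y1z.
have close w : d y w = 1%N -> d w z = n -> d x y = (d x w).+1 ->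
    forall m, (d x m + d m w = d x w)%N -> (d w m + d m z = n)%N ->
    (d x m + d m z = d x z)%N ->
    exists m, [/\ (d x m + d m y = d x y)%N, (d y m + d m z = n.+1)%N &
              (d x m + d m z = d x z)%N].
  move=> yw wz xy m' h1 h2 h3; exists m'.
  have := d_triangle w m' y; have := d_triangle w y m'.
  have := d_triangle m' x y; have := d_triangle m' y z.
  have := d_sym w y; have := d_sym y m'; have := d_sym w m'; move=> *.
  by split; lia.
case: (step _ _ x yy1) => [xy|xy1]; first exact: (close y1 yy1 y1z xy m).
have [y1m|y1m] := pselect (y1 = m).
  subst m; exists y; rewrite !d0 addn0; split=> //.
  have := d_triangle y x z; lia.
have [y2 [y12 y2m]] := d_step y1m.
have y2z : d y1 z = (d y2 z).+1.
  by have := d_triangle m y2 z; have := d_triangle y2 y1 z; lia.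
have xy2 : d x y1 = (d x y2).+1.
  have := d_triangle m x y2; have := d_triangle y2 x y1.
  by have := d_sym y2 y1; have := d_sym m y2; have := d_sym m y1; lia.
have yy2 : y <> y2 by move=> E; subst y2; lia.
have [t [yt y2t yx]] : exists t,
    [/\ d y t = 1%N, d y2 t = 1%N & d y x = (d t x).+1].
  apply: d_quadrangle yy2 _ y12 _ _; first by rewrite d_sym.
  - by rewrite (d_sym y1) (d_sym y).
  - by rewrite (d_sym y1) (d_sym y2).
have tz : d t z = n.
  have := d_triangle y2 t z; have := d_triangle t y z.
  by rewrite (d_sym t y2); lia.
have [m' [h1 h2 h3]] := IHn x t z tz.
by apply: (close t yt tz _ m') => //; rewrite (d_sym x y) (d_sym x t).
Qed.

End Modular.

(** * Contracting subsets are Morse *)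

Section ContractingMorse.
Variables (R : realType) (T : Type) (d : T -> T -> R) (Y : set T).
Hypothesis d0 : forall x, d x x = 0.
Hypothesis d_sym : forall x y, d x y = d y x.
Hypothesis d_triangle : forall y x z, d x z <= d x y + d y z.

Lemma pseudometric_ge0 x y : 0 <= d x y.
Proof. by have := d_triangle y x x; rewrite d0 (d_sym y x); lra. Qed.

Section Projection.
Variable pi : T -> T.
Hypothesis piY : forall x, Y (pi x).
Hypothesis pi_min : forall x y, Y y -> d x (pi x) <= d x y.
Variable C : R.
Hypothesis C_ge0 : 0 <= C.
Hypothesis contract : forall (x : T) (r : R),
  closed_ball_at d x r `&` Y = set0 ->
  forall y y', projection d Y (closed_ball_at d x r) y ->
    projection d Y (closed_ball_at d x r) y' -> d y y' <= C.

Lemma contract_step x z : d x z < d x (pi x) -> d (pi x) (pi z) <= C.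
Proof.
move=> xz; apply: (@contract x (d x z)).
- rewrite -subset0 => y [xy Yy]; have : d x y <= d x z := xy.
  by have := pi_min x Yy; lra.
- split=> //; exists x; last exact: pi_min.
  by rewrite /closed_ball_at /= d0 pseudometric_ge0.
- by split=> //; exists z; [exact: lexx|exact: pi_min].
Qed.

Lemma contract_chain (v : nat -> T) n :
  (forall j, (j < n)%N -> d (v j) (v j.+1) < d (v j) (pi (v j))) ->
  d (pi (v 0%N)) (pi (v n)) <= C * n%:R.
Proof.
elim: n => [_|n IHn vj]; first by rewrite d0 mulr0.
have {}IHn : d (pi (v 0%N)) (pi (v n)) <= C * n%:R.
  by apply: IHn => j jn; apply: vj; exact: ltnW.
have := contract_step (vj n (ltnSn n)).
have := d_triangle (pi (v n)) (pi (v 0%N)) (pi (v n.+1)).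
by rewrite -natr1; lra.
Qed.

(** Starting from time [t0], walk along the quasigeodesic with time step [l]
    until it comes close to Y. While it is at distance at least [D] from Y a
    step is shorter than that distance, hence moves the projection by at most
    [C]. *)
Lemma return_time (A B l D a b t0 : R) (g : R -> T) :
  0 < A -> 0 <= B -> 0 < l -> A * l + B < D -> a <= t0 <= b ->
  quasigeodesic d A B a b g -> Y (g b) ->
  exists n t, [/\ t0 <= t <= b, d (g t) (pi (g t)) < D,
    (n%:R - 1) * l <= t - t0 <= n%:R * l &
    d (pi (g t0)) (pi (g t)) <= C * n%:R].
Proof.
move=> A0 B0 l0 lD /andP[at0 t0b] qg Ygb.
pose u (i : nat) := Num.min b (t0 + i%:R * l).
have Dgt0 : 0 < D by have := mulr_gt0 A0 l0; lra.
have nearb : d (g b) (pi (g b)) < D.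
  by have := pi_min (g b) Ygb; rewrite d0; lra.
have ex : exists i, d (g (u i)) (pi (g (u i))) < D.
  exists (Num.truncn ((b - t0) / l)).+1.
  rewrite /u min_l //; have := truncnS_gt ((b - t0) / l).
  by rewrite ltr_pdivrMr //; lra.
have un i : t0 <= u i <= b.
  by rewrite /u ge_min lexx /= le_min t0b lerDl mulr_ge0 // ltW.
have [n near_n min_n] := ex_minnP ex.
exists n, (u n); split=> //.
- (* Before the last step the walk has not reached [b], where [g b] is in Y. *)
  apply/andP; split; last by rewrite lerBlDl ge_min lexx orbT.
  case: n near_n min_n => [|n] near_n min_n.
    by have /andP[] := un 0%N; lra.
  have u_lt : t0 + n%:R * l < b.
    rewrite ltNge; apply/negP => bn.
    have /min_n : d (g (u n)) (pi (g (u n))) < D by rewrite /u min_l.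
    by rewrite ltnn.
  rewrite -natr1 addrK lerBrDl le_min (ltW u_lt) /= lerD2l.
  by apply: ler_wpM2r; [exact: ltW|lra].
- have -> : g t0 = g (u 0%N) by rewrite /u mul0r addr0 min_r.
  apply: (contract_chain (v := fun i => g (u i))) => j jn.
  have far : D <= d (g (u j)) (pi (g (u j))).
    by rewrite leNgt; apply/negP => /min_n; rewrite leqNgt jn.
  have step : `|u j - u j.+1| <= l.
    rewrite /u -natr1 mulrDl mul1r ler_norml.
    by rewrite /Num.min; do 2![case: ltP => ?]; apply/andP; split; lra.
  have /andP[? ?] := un j; have /andP[? ?] := un j.+1.
  have /andP[_] : A^-1 * `|u j - u j.+1| - B <= d (g (u j)) (g (u j.+1))
      <= A * `|u j - u j.+1| + B by apply: qg; apply/andP; split; lra.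
  by have := ler_wpM2l (ltW A0) step; lra.
Qed.

(** Let [t1 <= t <= t2] be the times at which the quasigeodesic comes close to Y
    before and after [t], in [n1] and [n2] steps. Its endpoints at these times
    are at distance at least [((n1 + n2 - 2) * l) / A - B], as it is a
    quasigeodesic, and at most [2 * D + C * (n1 + n2)], by projection to Y. The
    step [l = A * (C + 1)] makes the first slope [C + 1], larger than [C], so
    that [n1 + n2] is bounded. *)
Lemma contracting_quasigeodesic (A B : R) : 0 < A -> 0 <= B ->
  exists2 K, 0 <= K & forall (a b : R) (g : R -> T),
    quasigeodesic d A B a b g -> Y (g a) -> Y (g b) ->
    forall t, a <= t <= b -> d (g t) (pi (g t)) <= K.
Proof.
move=> A0 B0; pose l := A * (C + 1); pose D := A * l + B + 1.
have l0 : 0 < l.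
  by apply: mulr_gt0 => //; have := C_ge0; lra.
have lD : A * l + B < D by rewrite /D; lra.
have Al0 : 0 < A * l by rewrite mulr_gt0.
pose M := 2 * D + B + 2 * (C + 1).
have D0 : 0 < D by rewrite /D; lra.
have M0 : 0 < M by rewrite /M; have := C_ge0; lra.
exists (A * (M * l) + B + D).
  by have := mulr_ge0 (ltW A0) (mulr_ge0 (ltW M0) (ltW l0)); lra.
move=> a b g qg Yga Ygb t /andP[att tb].
have [n2 [t2 [/andP[tt2 t2b] near2 /andP[n2l n2u] pi2]]] :=
  return_time A0 B0 l0 lD (introT andP (conj att tb)) qg Ygb.
(* The time before [t] is found on the reversed quasigeodesic. *)
have qg' : quasigeodesic d A B (- b) (- a) (fun s => g (- s)).
  move=> s s' /andP[? ?] /andP[? ?].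
  have := qg (- s) (- s'); rewrite -opprD normrN.
  by apply; apply/andP; split; lra.
have [n1 [t1' [/andP[t1t t1a] near1 /andP[n1l n1u] pi1]]] :
  exists n t1, [/\ - t <= t1 <= - a, d (g (- t1)) (pi (g (- t1))) < D,
    (n%:R - 1) * l <= t1 - (- t) <= n%:R * l &
    d (pi (g (- - t))) (pi (g (- t1))) <= C * n%:R].
  apply: (return_time A0 B0 l0 lD _ qg'); last by rewrite opprK.
  by apply/andP; split; lra.
move: (- t1') (opprK t1') => t1 Et1; subst t1'.
rewrite !opprK in near1 pi1 n1l n1u.
have /andP[low _] : A^-1 * `|t1 - t2| - B <= d (g t1) (g t2)
    <= A * `|t1 - t2| + B.
  by apply: qg; apply/andP; split; lra.
have /andP[_ up] : A^-1 * `|t - t2| - B <= d (g t) (g t2) <= A * `|t - t2| + B.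
  by apply: qg; apply/andP; split; lra.
have tri1 := d_triangle (pi (g t1)) (g t1) (g t2).
have tri2 := d_triangle (pi (g t2)) (pi (g t1)) (g t2).
have tri3 := d_triangle (pi (g t)) (pi (g t1)) (pi (g t2)).
rewrite (d_sym (pi (g t1)) (pi (g t))) in tri3.
rewrite (d_sym (pi (g t2)) (g t2)) in tri2.
have Mn : n1%:R + n2%:R <= M.
  have : A^-1 * ((n1%:R + n2%:R - 2) * l) <= A^-1 * `|t1 - t2|.
    apply: ler_wpM2l; first by rewrite invr_ge0 ltW.
    by rewrite distrC ger0_norm; lra.
  have -> : A^-1 * ((n1%:R + n2%:R - 2) * l) = (n1%:R + n2%:R - 2) * (C + 1).
    by rewrite /l; field; lra.
  by rewrite /M; lra.
have n1p : 0 <= n1%:R :> R by [].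
have : A * `|t - t2| <= A * (M * l).
  apply: ler_wpM2l; first exact: ltW.
  rewrite distrC ger0_norm; last by lra.
  by apply: (le_trans n2u); apply: ler_wpM2r; [exact: ltW|lra].
have := pi_min (g t) (piY (g t2)); have := d_triangle (g t2) (g t) (pi (g t2)).
lra.
Qed.

End Projection.

Theorem contracting_morse :
  (forall x, Y !=set0 -> exists2 p, Y p & forall y, Y y -> d x p <= d x y) ->
  contracting d Y -> morse d Y.
Proof.
move=> nearest [C C0 contract] A B A0 B0.
have [[y0 Yy0]|Y0] := pselect (Y !=set0); last first.
  by exists 0 => // a b g _ _ Yga; case: Y0; exists (g a).
have /choice[pi piP] x : exists p, Y p /\ forall y, Y y -> d x p <= d x y.
  by have [|p] := nearest x; [exists y0|exists p].
have [K K0 HK] := contracting_quasigeodesic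
  (fun x => (piP x).1) (fun x => (piP x).2) C0 contract A0 B0.
exists K => // a b g ab qg Yga Ygb t tab.
by exists (pi (g t)); [exact: (piP _).1|exact: HK tab].
Qed.

End ContractingMorse.

(** * Morse subsets of modular graphs are contracting *)

Section Walks.
Variables (V : Type) (d : V -> V -> nat).
Hypothesis d0 : forall u, d u u = 0%N.
Hypothesis d_sym : forall u v, d u v = d v u.
Hypothesis d_triangle : forall v u w, (d u w <= d u v + d v w)%N.
Hypothesis d_eq0 : forall u v, d u v = 0%N -> u = v.
Hypothesis d_step : forall u v, u <> v -> exists w,
  d u w = 1%N /\ d u v = (d w v).+1.

Definition walk (h : nat -> V) := forall i, (d (h i) (h i.+1) <= 1)%N.

Lemma walk_le h i j : walk h -> (i <= j)%N -> (d (h i) (h j) <= j - i)%N.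
Proof.
move=> hW /subnKC <-; rewrite addKn; elim: (j - i)%N => [|k IHk].
  by rewrite addn0 d0.
rewrite addnS; have := d_triangle (h (i + k)%N) (h i) (h (i + k).+1).
by have := hW (i + k)%N; lia.
Qed.

Lemma walk_geodesic h a b i j : walk h -> d (h a) (h b) = (b - a)%N ->
  (a <= i)%N -> (i <= j)%N -> (j <= b)%N -> d (h i) (h j) = (j - i)%N.
Proof.
move=> hW hab ai ij jb.
have := walk_le hW ai; have := walk_le hW ij; have := walk_le hW jb.
have := d_triangle (h i) (h a) (h b); have := d_triangle (h j) (h i) (h b).
lia.
Qed.

Lemma geodesic_walk u v : exists h, [/\ walk h, h 0%N = u & h (d u v) = v].
Proof.
move En : (d u v) => n; elim: n u En => [|n IHn] u uv.
  by exists (fun=> u); split=> // [i|]; [rewrite d0|exact: d_eq0].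
have [w [uw wv]] : exists w, d u w = 1%N /\ d u v = (d w v).+1.
  by apply: d_step => E; rewrite E d0 in uv.
have [|h [hW h0 hn]] := IHn w; first lia.
exists (fun i => if i is i'.+1 then h i' else u); split=> // -[|i] //=.
by rewrite h0 uw.
Qed.

Lemma walk_cat h1 h2 n : walk h1 -> walk h2 -> h1 n = h2 0%N ->
  exists h, [/\ walk h, forall i, (i <= n)%N -> h i = h1 i
    & forall i, h (n + i)%N = h2 i].
Proof.
move=> W1 W2 h12; exists (fun i => if (i <= n)%N then h1 i else h2 (i - n)%N).
split=> [i|i -> //|i]; last first.
  by case: ifP => [|_]; [case: i => [|i]; [rewrite addn0|lia]|rewrite addKn].
case: (ltngtP i n) => [lt_in|lt_ni|->].
- exact: W1.
- by rewrite subSn ?(ltnW lt_ni).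
- by rewrite subSnn h12.
Qed.

Lemma geodesic_walk_via u m v : exists h,
  [/\ walk h, h 0%N = u, h (d u m) = m & h (d u m + d m v)%N = v].
Proof.
have [h1 [W1 h10 h1m]] := geodesic_walk u m.
have [h2 [W2 h20 h2v]] := geodesic_walk m v.
have [h [hW hl hr]] := walk_cat W1 W2 (etrans h1m (esym h20)).
exists h; rewrite hr hl // h10 hl // h1m h2v; split=> //.
Qed.

Variable R : realType.
Let dR u v : R := (d u v)%:R.

(** Sampling a walk at integral times costs at most 1 in each inequality. *)
Lemma walk_quasigeodesic h a c L : walk h -> (0 < a)%N ->
  (forall i j, (i <= j)%N -> (j <= L)%N ->
     (j - i <= a * d (h i) (h j) + c)%N) ->
  quasigeodesic dR a%:R (c%:R + 1) 0 L%:R (fun t => h (Num.truncn t)).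
Proof.
move=> hW a0 hL s t; wlog st : s t / s <= t.
  case: (leP s t) => [|/ltW] st ih sP tP; first exact: ih.
  by rewrite distrC /dR d_sym; exact: ih.
move=> /andP[s0 sL] /andP[t0 tL].
have a1 : 1 <= a%:R :> R by rewrite ler1n.
have ij : (Num.truncn s <= Num.truncn t)%N by exact: le_truncn.
have jL : (Num.truncn t <= L)%N.
  by rewrite -(ler_nat R); apply: le_trans tL; rewrite truncn_le.
have := walk_le hW ij; have := hL _ _ ij jL.
have /andP[s1 s2] := truncn_itv s0; have /andP[t1 t2] := truncn_itv t0.
rewrite distrC ger0_norm ?subr_ge0 // /dR -!natr1 in s2 t2 *.
rewrite -!(ler_nat R) natrB // natrD natrM => low up.
have a_pos : 0 < a%:R :> R by lra.
have c0 : 0 <= c%:R :> R by [].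
apply/andP; split; last first.
  by have := ler_peMl (_ : 0 <= t - s) a1; rewrite subr_ge0 => /(_ st); lra.
rewrite lerBlDr ler_pdivrMl // mulrDr mulrDr mulr1.
by have := ler_peMl c0 a1; lra.
Qed.

Variable Y : set V.
Hypothesis Y_morse : morse dR Y.

Lemma morse_walk a c : (0 < a)%N -> exists K, forall h L, walk h ->
  Y (h 0%N) -> Y (h L) ->
  (forall i j, (i <= j)%N -> (j <= L)%N ->
     (j - i <= a * d (h i) (h j) + c)%N) ->
  forall i, (i <= L)%N -> exists2 y, Y y & (d (h i) y <= K)%N.
Proof.
move=> a0; have c0 : 0 <= c%:R + 1 :> R by rewrite addr_ge0.
have a0R : 0 < a%:R :> R by rewrite ltr0n.
have [K K0 HK] := Y_morse a0R c0; exists (Num.truncn K) => h L hW Y0 YL hL i iL.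
have L0 : 0 <= L%:R :> R by [].
have := HK 0 L%:R _ L0 (walk_quasigeodesic hW a0 hL).
rewrite -[0]/(0%:R) !natrK => /(_ Y0 YL i%:R); rewrite !ler_nat iL natrK.
by case=> // y Yy; exists y => //; rewrite truncn_ge_nat.
Qed.

Hypothesis d_median : forall x y z, exists m,
  [/\ between d x m y, between d y m z & between d x m z].

Definition nearest (x p : V) := Y p /\ forall y, Y y -> (d x p <= d x y)%N.

(** A nearest point is almost a gate. The median [m] of [x], [p] and [s] is on a
    geodesic between two points of Y, hence close to Y by the Morse property,
    and on a geodesic from [x] to the nearest point [p] of Y, hence close to
    [p]. *)
Lemma morse_gate : exists K, forall x p s, nearest x p -> Y s ->
  (d x p + d p s <= d x s + K)%N.
Proof.
have [K HK] := @morse_walk 1 0 isT; exists K.*2 => x p s [Yp p_min] Ys.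
have [m [xmp pms xms]] := d_median x p s; rewrite /between in xmp pms xms.
have [h [hW hp hm hs]] := geodesic_walk_via p m s.
rewrite pms in hs.
have [||i j ij jL||y Yy hy] := HK h (d p s) hW _ _ _ (d p m);
  rewrite ?hp ?hs //.
- by rewrite (@walk_geodesic h 0 (d p s)) ?hp ?hs ?subn0 // mul1n addn0.
- by rewrite -pms leq_addr.
have := p_min y Yy; have := d_triangle m x y; have := d_triangle p m p.
by rewrite hm in hy; have := d_sym m p; lia.
Qed.

(** Let [m] be a median of [x], [p] and [z]. As [p] and [q] are almost gates,
    the distance [d p m] is about [d p q / 2] at least, because [x] and [z] are
    not much further apart than [x] and [p]. Let [u] be the vertex at distance
    [k = min (d p m) (d p q / 2)] from [p] on a geodesic from [p] to [m], and
    [n] a median of [u], [q] and [z]. The path through [p], [u], [n] and [q] is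
    geodesic from [p] to [n], being on the way from [p] to [z], and from [u] to
    [q]. A point before [u] and a point after [n] are almost projected to [p]
    and to [q], respectively, so that their distance is almost [d p q], while
    the whole path has length at most [2 * d p q]. Thus it is a quasigeodesic
    with uniform constants, and [u] is close to Y by the Morse property. As [u]
    is on a geodesic from [x] to [p], its distance to Y is [k]; hence [k], and
    with it [d p q], is bounded. *)
Theorem morse_coarse_contracting c : exists K, forall x z p q,
  nearest x p -> nearest z q -> (d x z <= d x p + c)%N -> (d p q <= K)%N.
Proof.
have [K0 gate] := morse_gate.
have [K1 HK] := @morse_walk 2 (2 * K0) isT.
exists (2 * K1 + K0 + c + 2)%N => x z p q px qz xz.
have gx := gate x p q px (proj1 qz); have gz := gate z q p qz (proj1 px).
have [m [xmp pmz xmz]] := d_median x p z; rewrite /between in xmp pmz xmz.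
pose k := minn (d p m) (d p q)./2.
have [u [km um]] : exists u, d p u = k /\ d u m = (d p m - k)%N.
  have [h [hW h0 hm]] := geodesic_walk p m; exists (h k).
  have kle : (k <= d p m)%N by rewrite geq_minl.
  have geo i j := @walk_geodesic h 0 (d p m) i j hW.
  rewrite h0 hm subn0 in geo; have {}geo i j := geo i j erefl.
  split=> //; first by rewrite -{1}h0 geo // subn0.
  by rewrite -{1}hm geo.
have kle : (k <= d p m)%N by rewrite geq_minl.
have k2 : (k <= (d p q)./2)%N by rewrite geq_minr.
have pux : (d p u + d u x = d p x)%N.
  have := d_triangle u p x; have := d_triangle m u x.
  by have := d_sym m x; have := d_sym p m; have := d_sym p x; lia.
have puz : (d p u + d u z = d p z)%N.
  by have := d_triangle u p z; have := d_triangle m u z; lia.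
have [n [unq qnz unz]] := d_median u q z; rewrite /between in unq qnz unz.
have pun : (d p u + d u n = d p n)%N.
  by have := d_triangle u p n; have := d_triangle n p z; lia.
have [h1 [W1 h10 h1u h1n]] := geodesic_walk_via p u n.
have [h2 [W2 h20 h2q]] := geodesic_walk n q.
have [h [hW hl hr]] := walk_cat W1 W2 (etrans h1n (esym h20)).
have hp : h 0%N = p by rewrite hl.
have hu : h (d p u) = u by rewrite hl ?leq_addr.
have hn : h (d p u + d u n)%N = n by have := hr 0%N; rewrite addn0 h20.
have hq : h (d p u + d u n + d n q)%N = q by rewrite hr.
set L := (d p u + d u n + d n q)%N in hq.
have qu : d u q = (d u n + d n q)%N by have := d_sym n q; lia.
have L2 : (L <= 2 * d p q)%N.
  have := d_triangle p u q; have := d_sym u p; have := odd_double_half (d p q).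
  by rewrite /L; lia.
have low i j : (i <= j)%N -> (j <= L)%N ->
    (j - i <= 2 * d (h i) (h j) + 2 * K0)%N.
  move=> ij jL.
  have [jn|nj] := leqP j (d p u + d u n).
    have := @walk_geodesic h 0 (d p u + d u n) i j hW.
    by rewrite hp hn subn0 => ->; lia.
  have [ui|iu] := leqP (d p u) i.
    have := @walk_geodesic h (d p u) L i j hW.
    by rewrite hu hq qu => ->; rewrite ?/L; lia.
  have p_i : d p (h i) = i.
    rewrite -{1}hp (@walk_geodesic h 0 (d p u)) // ?subn0 ?hp ?hu //; lia.
  have i_u : d (h i) u = (d p u - i)%N.
    rewrite -{1}hu (@walk_geodesic h 0 (d p u)) // ?subn0 ?hp ?hu //; lia.
  have n_j : d n (h j) = (j - (d p u + d u n))%N.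
    rewrite -{1}hn (@walk_geodesic h (d p u + d u n) L) // ?hn ?hq /L; lia.
  have j_q : d (h j) q = (L - j)%N.
    rewrite -{1}hq (@walk_geodesic h (d p u + d u n) L) // ?hn ?hq /L; lia.
  (* The distance from [h i] to [q], and the one from [h j] to [p], are
     bounded below by the gate inequalities at [x] and at [z]; the sum of the
     triangle inequalities [t1] and [t2] then bounds [d (h i) (h j)]. *)
  have xi := d_triangle u x (h i); have xiq := d_triangle (h i) x q.
  have zj := d_triangle n z (h j); have zjp := d_triangle (h j) z p.
  have t1 := d_triangle (h j) (h i) q; have t2 := d_triangle (h i) (h j) p.
  have E1 := d_sym x u; have E2 := d_sym x p; have E3 := d_sym u (h i).
  have E4 := d_sym z n; have E5 := d_sym z q; have E6 := d_sym (h i) (h j).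
  have E7 := d_sym (h i) p; have E8 := d_sym q p; have E9 := d_sym n q.
  rewrite /L in j_q jL; lia.
have Yp : Y (h 0%N) by rewrite hp; case: px.
have Yq : Y (h L) by rewrite hq; case: qz.
have [|y Yy] := HK h L hW Yp Yq low (d p u); first by rewrite /L; lia.
rewrite hu => uy.
have := proj2 px y Yy; have := d_triangle u x y.
have := d_sym x u; have := d_sym x p; have := d_sym z p; have := d_sym q p.
have := d_sym m x; have := d_sym p m; have := odd_double_half (d p q).
have := d_sym m p; have := d_sym x z; rewrite /k in km.
by move: km; rewrite /minn; case: ltnP; lia.
Qed.
End Walks.

(** * From vertices to the one-skeleton *)

Section Skeleton.
Variables (R : realType) (X : cubeComplex).
Hypothesis cat0 : CAT0 X.
Local Notation sk := (@skeleton_dist X R).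

Definition vdist (u v : X 0%N) : R := (vertex_dist u v)%:R.

Lemma vdist_triangle v u w : vdist u w <= vdist u v + vdist v w.
Proof. by rewrite /vdist -natrD ler_nat; exact: vertex_dist_triangle. Qed.

Lemma vdist_sym u v : vdist u v = vdist v u.
Proof. by rewrite /vdist vertex_dist_sym. Qed.

Lemma vdist_edge e : vdist (source e) (target e) = 1.
Proof. by rewrite /vdist vertex_dist_edge. Qed.

Lemma vdist_ge0 u v : 0 <= vdist u v. Proof. exact: ler0n. Qed.

Definition round (p : skeleton X R) : X 0%N :=
  match p with Vertex u => u | @Interior _ _ e _ _ => source e end.

Lemma dist_to_vertex_round p v :
  `|dist_to_vertex p v - vdist (round p) v| <= 1.
Proof.
case: p => [u|e t /andP[t0 t1]] /=; first by rewrite subrr normr0.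
have := vdist_triangle (target e) (source e) v.
have := vdist_triangle (source e) (target e) v.
rewrite (vdist_sym (target e) (source e)) vdist_edge ler_norml /vdist.
by rewrite /Num.min; case: ltP => ? ? ?; apply/andP; split; lra.
Qed.

Lemma skeleton_dist_round p q : `|sk p q - vdist (round p) (round q)| <= 2.
Proof.
case: q => [v|f s /andP[s0 s1]] /=.
  by apply: le_trans (dist_to_vertex_round p v) _; lra.
set through := Num.min _ _.
have thr : `|through - vdist (round p) (source f)| <= 2.
  have := dist_to_vertex_round p (source f).
  have := dist_to_vertex_round p (target f).
  have := vdist_triangle (target f) (round p) (source f).
  have := vdist_triangle (source f) (round p) (target f).
  rewrite (vdist_sym (target f) (source f)) vdist_edge !ler_norml.
  move=> ? ? /andP[? ?] /andP[? ?].
  by rewrite /through /Num.min; case: ltP => ?; apply/andP; split; lra.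
have thr0 : 0 <= through.
  have dge0 v : 0 <= dist_to_vertex p v.
    case: p {through thr} => [u|e t /andP[t0 t1]] /=; first exact: ler0n.
    by rewrite le_min; apply/andP; split; apply: addr_ge0 => //; lra.
  by rewrite le_min; apply/andP; split; apply: addr_ge0 => //; lra.
(* On a common edge both the direct segment and the distance between the rounded
   points have length at most 1. *)
have near (x : R) : 0 <= x <= 1 -> vdist (round p) (source f) <= 1 ->
    `|Num.min x through - vdist (round p) (source f)| <= 2.
  move=> /andP[x0 x1] d1; have := vdist_ge0 (round p) (source f).
  move: thr; rewrite !ler_norml => /andP[? ?] ?.
  by rewrite /Num.min; case: ltP => ?; apply/andP; split; lra.
clearbody through; case: p thr near => [//|e t t01] thr near.
have /andP[t0 t1] := t01.
case: ifPn => [/asboolP ef|_].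
  apply: near => /=.
    by rewrite normr_ge0 ler_norml; apply/andP; split; lra.
  by rewrite ef /vdist vertex_dist0.
case: ifPn => [/asboolP ef|_ //].
apply: near => /=.
  by rewrite normr_ge0 ler_norml; apply/andP; split; lra.
by rewrite ef source_reverse vdist_sym vdist_edge.
Qed.

Variable S : set (X 0%N).
Local Notation Y := (Vertex @` S : set (skeleton X R)).

Lemma contracting_vertices : contracting sk Y -> contracting vdist S.
Proof.
move=> [K K0 HK]; exists K => // x r xr y y'.
move=> [Sy [z zx zmin]] [Sy' [z' zx' zmin']].
apply: (HK (Vertex x) r _ (Vertex y) (Vertex y')).
- rewrite -subset0 => w [wr [v Sv wE]]; rewrite -wE in wr.
  have : (closed_ball_at vdist x r `&` S) v by [].
  by rewrite xr.
- split; first by exists y.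
  by exists (Vertex z) => // _ [v Sv <-]; exact: zmin.
- split; first by exists y'.
  by exists (Vertex z') => // _ [v Sv <-]; exact: zmin'.
Qed.

Lemma morse_vertices : morse sk Y -> morse vdist S.
Proof.
move=> mY A B A0 B0; have [K K0 HK] := mY A B A0 B0; exists K => //.
move=> a b g ab qg Sa Sb t tab.
have [] := HK a b (Vertex \o g) ab qg _ _ t tab;
  [by exists (g a)|by exists (g b)|].
by move=> _ [y Sy <-] gty; exists y.
Qed.

Lemma morse_skeleton : morse vdist S -> morse sk Y.
Proof.
move=> mS A B A0 B0; have B2 : 0 <= B + 2 by lra.
have [K K0 HK] := mS A (B + 2) A0 B2; exists (K + 2); first lra.
move=> a b g ab qg [u Su gu] [v Sv gv] t tab.
have [|||y Sy yK] := HK a b (round \o g) ab _ _ _ t tab.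
- move=> s s' sP s'P; have := skeleton_dist_round (g s) (g s').
  have /andP[? ?] := qg s s' sP s'P; rewrite ler_norml /= => /andP[? ?].
  by apply/andP; split; lra.
- by rewrite /= -gu.
- by rewrite /= -gv.
exists (Vertex y); first by exists y.
have := skeleton_dist_round (g t) (Vertex y).
by rewrite ler_norml /= in yK * => /andP[_]; rewrite /=; lra.
Qed.

Lemma nearest_exists (x : X 0%N) :
  S !=set0 -> exists p, nearest (@vertex_dist X) S x p.
Proof.
move=> [s Ss]; pose P n := `[< exists2 p, S p & vertex_dist x p = n >].
have exP : exists n, P n by exists (vertex_dist x s); apply/asboolP; exists s.
have [n /asboolP[p Sp xp] nmin] := ex_minnP exP.
by exists p; split=> // y Sy; rewrite xp; apply: nmin; apply/asboolP; exists y.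
Qed.

(** If [s] is nearest to a point of an edge, it is nearest to the end of the
    edge through which a geodesic from this point to [s] leaves the edge. *)
Lemma nearest_end (z : skeleton X R) s : S s ->
  (forall y, S y -> sk z (Vertex s) <= sk z (Vertex y)) ->
  exists z',
    nearest (@vertex_dist X) S z' s /\ (vertex_dist (round z) z' <= 1)%N.
Proof.
move=> Ss; case: z => [u|e t /andP[t0 t1]] /= smin.
  exists u; split; last by rewrite vertex_dist0.
  by split=> // y Sy; have := smin y Sy; rewrite ler_nat.
case: (leP (t + (vertex_dist (source e) s)%:R)
           (1 - t + (vertex_dist (target e) s)%:R)) => E.
- exists (source e); split; last by rewrite vertex_dist0.
  split=> // y Sy; have := smin y Sy; rewrite (min_l E) le_min => /andP[+ _].
  by rewrite lerD2l ler_nat.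
- exists (target e); split; last by rewrite vertex_dist_edge.
  split=> // y Sy; have := smin y Sy.
  by rewrite (min_r (ltW E)) le_min => /andP[_]; rewrite lerD2l ler_nat.
Qed.

(** Replacing the centre of a ball and one of its points by nearby vertices
    [round x] and [z'] costs 2 + 2 + 1 in the hypothesis that the ball is
    disjoint from Y; all projections are then compared with a vertex nearest to
    [round x]. *)
Lemma coarse_contracting_skeleton :
  (exists K, forall x z p q, nearest (@vertex_dist X) S x p ->
     nearest (@vertex_dist X) S z q ->
     (vertex_dist x z <= vertex_dist x p + 5)%N -> (vertex_dist p q <= K)%N) ->
  contracting sk Y.
Proof.
move=> [K HK]; exists (K + K)%:R => // x r xr.
have [S0|S0] := pselect (S !=set0); last first.
  by move=> y y' [[s Ss _]]; case: S0; exists s.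
have [p px] := nearest_exists (round x) S0.
have close y : projection sk Y (closed_ball_at sk x r) y ->
    exists2 s, y = Vertex s & (vertex_dist p s <= K)%N.
  move=> [[s Ss <-] [z zx zmin]]; exists s => //.
  have [|z' [z's zz']] := @nearest_end z s Ss.
    by move=> y' Sy'; apply: zmin; exists y'.
  apply: (HK (round x) z' p s) => //.
  rewrite -(ler_nat R) natrD.
  have rp : r < sk x (Vertex p).
    rewrite ltNge; apply/negP => xp.
    have : (closed_ball_at sk x r `&` Y) (Vertex p).
      by split=> //; exists p => //; case: px.
    by rewrite xr.
  have : sk x z <= r := zx.
  have : `|sk x (Vertex p) - vdist (round x) p| <= 2.
    exact: skeleton_dist_round x (Vertex p).
  have := skeleton_dist_round x z.
  have := vdist_triangle (round z) (round x) z'.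
  have : vdist (round z) z' <= 1 by rewrite /vdist (ler_nat R _ 1).
  rewrite !ler_norml /vdist => ? ? /andP[? ?] /andP[? ?] ?.
  lra.
move=> y y' /close[s -> ps] /close[s' -> ps'] /=; rewrite ler_nat.
apply: leq_trans (vertex_dist_triangle cat0 p s s') _.
by rewrite (vertex_dist_sym cat0 s p) leq_add.
Qed.

End Skeleton.

(** * The equivalence *)

Theorem lemma4p6 (R : realType) (X : cubeComplex) (S : set (X 0%N)) :
  CAT0 X -> finite_dimensional X ->
  morse (@skeleton_dist X R) (Vertex @` S) <->
  contracting (@skeleton_dist X R) (Vertex @` S).
Proof.
move=> cat0 _; split.
- move/morse_vertices => mS; apply: coarse_contracting_skeleton => //.
  apply: morse_coarse_contracting mS _ 5%N.
  + exact: vertex_dist0.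
  + exact: vertex_dist_sym.
  + exact: vertex_dist_triangle.
  + exact: vertex_dist_eq0.
  + exact: vertex_dist_step.
  + apply: median.
    * exact: vertex_dist0.
    * exact: vertex_dist_sym.
    * exact: vertex_dist_triangle.
    * exact: vertex_dist_eq0.
    * exact: vertex_dist_parity.
    * exact: vertex_dist_step.
    * exact: quadrangle.
- move/contracting_vertices => cS; apply: morse_skeleton => //.
  apply: contracting_morse cS.
  + by move=> x; rewrite /vdist vertex_dist0.
  + exact: vdist_sym.
  + exact: vdist_triangle.
  + move=> x /(nearest_exists x)[p [Sp pmin]]; exists p => // y Sy.
    by rewrite ler_nat pmin.
Qed.
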